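(* Let $r,s,t$ be real numbers with $t\ne 0$, let $W_0,W_1,W_2$ be complex numbers, and let $(W_n)_{n\in\mathbb{Z}}$ be the generalized Tribonacci sequence, i.e. the unique two-sided sequence with these values at $0,1,2$ satisfying $W_n=rW_{n-1}+sW_{n-2}+tW_{n-3}$ for all integers $n$. Then for every integer $n\ge 1$: (a) If $r+s+t-1\neq 0$, then $$\sum_{k=1}^{n}W_{-k}=\frac{-(r+s+t)W_{-n-1}-(s+t)W_{-n-2}-tW_{-n-3}+W_{2}+(1-r)W_{1}+(1-r-s)W_{0}}{r+s+t-1}.$$ (b) If $(r+s+t-1)(r-s+t+1)\neq 0$, then $$\sum_{k=1}^{n}W_{-2k}=\frac{-(r+t)W_{-2n+1}+(r^{2}+rt+s-1)W_{-2n}+(st-t)W_{-2n-1}+(1-s)W_{2}+(t+rs)W_{1}+(1-rt-2s-r^{2}+s^{2})W_{0}}{(r+s+t-1)(r-s+t+1)}$$ and $$\sum_{k=1}^{n}W_{-2k+1}=\frac{(s-1)W_{-2n+1}-(t+rs)W_{-2n}-(t^{2}+rt)W_{-2n-1}+(r+t)W_{2}+(1-r^{2}-rt-s)W_{1}+(t-st)W_{0}}{(r+s+t-1)(r-s+t+1)}.$$ (c) If $(r+s+t-1)(r-s+t+1)\neq 0$, $r+t=0$ and $s\neq 1$, then $$\sum_{k=1}^{n}W_{-2k}=\frac{-W_{-2n}-tW_{-2n-1}+W_{2}+tW_{1}+(1-s)W_{0}}{s-1}$$ and $$\sum_{k=1}^{n}W_{-2k+1}=\frac{1}{s-1}\l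eft(-W_{-2n+1}-tW_{-2n}+W_{1}+tW_{0}\right).$$
   Context: The terms with negative subscripts are defined (for $t\neq 0$) by $W_{-n}=-\frac{s}{t}W_{-(n-1)}-\frac{r}{t}W_{-(n-2)}+\frac{1}{t}W_{-(n-3)}$ for $n=1,2,3,\dots$, so that the recurrence $W_n=rW_{n-1}+sW_{n-2}+tW_{n-3}$ holds for all integers $n$. *)

(* Defs.v *)
From HB Require Import structures.
From mathcomp Require Import all_boot all_order all_algebra.
From mathcomp Require Import ring.
From mathcomp Require Import reals complex.

Set Implicit Arguments.
Unset Strict Implicit.
Unset Printing Implicit Defensive.

Import Order.TTheory GRing.Theory Num.Theory.
Local Open Scope ring_scope.
Local Open Scope complex_scope.

Definition is_gtrib (R : realType) (r s t : R) (W0 W1 W2 : R[i])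
    (W : int -> R[i]) : Prop :=
  [/\ W 0 = W0, W 1 = W1, W 2 = W2 &
      forall n : int,
        W n = r%:C * W (n - 1) + s%:C * W (n - 2) + t%:C * W (n - 3)].

(* For t != 0, is_gtrib determines exactly one two-sided sequence, and its
   terms of negative index obey the recurrence solved for W (n - 3). *)

Lemma is_gtrib_neg (R : realType) (r s t : R) (W0 W1 W2 : R[i])
    (W : int -> R[i]) :
  t != 0 -> is_gtrib r s t W0 W1 W2 W ->
  forall n : int,
    W (- n) = - (s / t)%:C * W (- (n - 1)) - (r / t)%:C * W (- (n - 2))
              + (1 / t)%:C * W (- (n - 3)).
Proof.
move=> t0 [_ _ _ rec] n.
have tC0 : t%:C != 0 :> R[i] by rewrite fmorph_eq0.
have := rec (3 - n).
have -> : 3 - n - 1 = - (n - 2) :> int by ring.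
have -> : 3 - n - 2 = - (n - 1) :> int by ring.
have -> : 3 - n - 3 = - n :> int by ring.
have -> : 3 - n = - (n - 3) :> int by ring.
by move=> ->; rewrite !fmorph_div rmorph1; field.
Qed.

Lemma is_gtrib_exists (R : realType) (r s t : R) (W0 W1 W2 : R[i]) :
  t != 0 -> exists W, is_gtrib r s t W0 W1 W2 W.
Proof.
move=> t0; have tC0 : t%:C != 0 :> R[i] by rewrite fmorph_eq0.
pose fwd (x : R[i] * R[i] * R[i]) :=
  (x.1.2, x.2, r%:C * x.2 + s%:C * x.1.2 + t%:C * x.1.1).
pose bwd (x : R[i] * R[i] * R[i]) :=
  ((x.2 - r%:C * x.1.2 - s%:C * x.1.1) / t%:C, x.1.1, x.1.2).
have fwdK x : fwd (bwd x) = x.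
  by case: x => [[a b] c]; rewrite /fwd /bwd /=; congr (_, _, _); field.
pose st (n : int) := match n with
  | Posz m => iter m fwd (W0, W1, W2)
  | Negz m => iter m.+1 bwd (W0, W1, W2) end.
have stS n : st (n + 1) = fwd (st n).
  case: n => [m|[|m]].
  - by rewrite -PoszD addn1.
  - exact/esym/fwdK.
  - have -> : Negz m.+1 + 1 = Negz m by rewrite !NegzE -addn1 PoszD; ring.
    exact/esym/fwdK.
exists (fun n => (st n).1.1); split=> // n.
have -> : n - 1 = n - 3 + 1 + 1 by ring.
have -> : n - 2 = n - 3 + 1 by ring.
have {1}-> : n = n - 3 + 1 + 1 + 1 by ring.
by rewrite !stS.
Qed.

Lemma is_gtrib_unique (R : realType) (r s t : R) (W0 W1 W2 : R[i])
    (W W' : int -> R[i]) :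
  t != 0 -> is_gtrib r s t W0 W1 W2 W -> is_gtrib r s t W0 W1 W2 W' ->
  W =1 W'.
Proof.
move=> t0 HW HW'.
pose P n := [/\ W n = W' n, W (n + 1) = W' (n + 1) & W (n + 2) = W' (n + 2)].
suff H n : P n by move=> n; case: (H n).
have P0 : P 0.
  by case: HW HW' => h0 h1 h2 _ [k0 k1 k2 _]; split;
    rewrite ?add0r ?h0 ?h1 ?h2.
have PS m : P m -> P (m + 1).
  case=> e0 e1 e2; split; rewrite -?addrA //.
  case: HW HW' => _ _ _ h [_ _ _ k]; rewrite h k.
  have -> : m + (1 + 2) - 1 = m + 2 by ring.
  have -> : m + (1 + 2) - 2 = m + 1 by ring.
  have -> : m + (1 + 2) - 3 = m by ring.
  by rewrite e0 e1 e2.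
have PB m : P m -> P (m - 1).
  case=> e0 e1 e2; split.
  - have := is_gtrib_neg t0 HW (1 - m); have := is_gtrib_neg t0 HW' (1 - m).
    have -> : - (1 - m - 1) = m by ring.
    have -> : - (1 - m - 2) = m + 1 by ring.
    have -> : - (1 - m - 3) = m + 2 by ring.
    by rewrite opprB e0 e1 e2 => -> ->.
  - by rewrite subrK.
  - by have -> : m - 1 + 2 = m + 1 by ring.
elim: n => // n Pn.
  by rewrite -addn1 PoszD; apply: PS.
by rewrite -addn1 PoszD opprD; apply: PB.
Qed.

(* Main.v *)
(* Each right-hand side times its denominator d telescopes: as a function G of
   n it vanishes at n = 0, and the recurrence turns G (n + 1) - G n into d times
   the summand of index n + 1. In (c), r = - t makes the common denominator of
   (b) equal to - (s - 1)^2, and the factor s - 1 cancels. *)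

Require Import Defs.
From HB Require Import structures.
From mathcomp Require Import all_boot all_order all_algebra.
From mathcomp Require Import ring.
From mathcomp Require Import reals complex.

Set Implicit Arguments.
Unset Strict Implicit.
Unset Printing Implicit Defensive.

Import Order.TTheory GRing.Theory Num.Theory.
Local Open Scope ring_scope.
Local Open Scope complex_scope.

(** Dividing by [d] only at the end leaves two division-free goals on the numerator [G], both within
    reach of [ring]. *)
Lemma telescope_sum_div (F : fieldType) (d : F) (f G : nat -> F) :
  d != 0 -> G 0 = 0 -> (forall k, G k.+1 = G k + d * f k.+1) ->
  forall n, \sum_(1 <= k < n.+1) f k = G n / d.
Proof.
move=> d0 G0 GS n; apply/(canRL (mulfK d0)).
elim: n => [|n IHn]; first by rewrite big_geq ?mul0r ?G0.
by rewrite big_nat_recr //= mulrDl IHn GS [_ * d]mulrC.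
Qed.

Theorem theorem3p1 (R : realType) (r s t : R) (ht : t != 0)
    (W0 W1 W2 : R[i]) (W : int -> R[i])
    (hW : is_gtrib r s t W0 W1 W2 W) (n : nat) (hn : (1 <= n)%N) :
  [/\ (* (a) *)
      r + s + t - 1 != 0 ->
      \sum_(1 <= k < n.+1) W (- k%:Z) =
        (- (r + s + t)%:C * W (- n%:Z - 1) - (s + t)%:C * W (- n%:Z - 2)
         - t%:C * W (- n%:Z - 3)
         + W2 + (1 - r)%:C * W1 + (1 - r - s)%:C * W0)
        / (r + s + t - 1)%:C,
      (* (b) *)
      (r + s + t - 1) * (r - s + t + 1) != 0 ->
      \sum_(1 <= k < n.+1) W (- (2 * k%:Z)) =
        (- (r + t)%:C * W (- (2 * n%:Z) + 1)
         + (r ^+ 2 + r * t + s - 1)%:C * W (- (2 * n%:Z))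
         + (s * t - t)%:C * W (- (2 * n%:Z) - 1)
         + (1 - s)%:C * W2 + (t + r * s)%:C * W1
         + (1 - r * t - 2 * s - r ^+ 2 + s ^+ 2)%:C * W0)
        / ((r + s + t - 1) * (r - s + t + 1))%:C
      /\
      \sum_(1 <= k < n.+1) W (- (2 * k%:Z) + 1) =
        ((s - 1)%:C * W (- (2 * n%:Z) + 1)
         - (t + r * s)%:C * W (- (2 * n%:Z))
         - (t ^+ 2 + r * t)%:C * W (- (2 * n%:Z) - 1)
         + (r + t)%:C * W2 + (1 - r ^+ 2 - r * t - s)%:C * W1
         + (t - s * t)%:C * W0)
        / ((r + s + t - 1) * (r - s + t + 1))%:C
    & (* (c) *)
      (r + s + t - 1) * (r - s + t + 1) != 0 -> r + t = 0 -> s != 1 ->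
      \sum_(1 <= k < n.+1) W (- (2 * k%:Z)) =
        (- W (- (2 * n%:Z)) - t%:C * W (- (2 * n%:Z) - 1)
         + W2 + t%:C * W1 + (1 - s)%:C * W0)
        / (s - 1)%:C
      /\
      \sum_(1 <= k < n.+1) W (- (2 * k%:Z) + 1) =
        1 / (s - 1)%:C *
        (- W (- (2 * n%:Z) + 1) - t%:C * W (- (2 * n%:Z))
         + W1 + t%:C * W0)].
Proof.
clear hn; have [h0 h1 h2 rec] := hW.
have rec1 m : W (m + 1) = r%:C * W m + s%:C * W (m - 1) + t%:C * W (m - 2).
  by rewrite rec addrK; congr (_ + _ * W _ + _ * W _); ring.
(* The recurrence at 2, 1 and 0 ties the initial values to the negative-index terms that survive in
   [G 0]. *)
have w2 : W2 = r%:C * W1 + s%:C * W0 + t%:C * W (-1).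
  by rewrite -h2 -h1 -h0 rec.
have w1 : W1 = r%:C * W0 + s%:C * W (-1) + t%:C * W (-2).
  by rewrite -h1 -h0 rec.
have w0 : W0 = r%:C * W (-1) + s%:C * W (-2) + t%:C * W (-3).
  by rewrite -h0 rec.
have evenS k : - (2 * k.+1%:Z) = - (2 * k%:Z) - 2 by rewrite (intS k); ring.
have oddS k : - (2 * k.+1%:Z) + 1 = - (2 * k%:Z) - 1 by rewrite evenS; ring.
have odd'S k : - (2 * k.+1%:Z) - 1 = - (2 * k%:Z) - 3 by rewrite evenS; ring.
have C_neq0 (x : R) : x != 0 -> x%:C != 0 :> R[i] by rewrite fmorph_eq0.
split=> [d0 | d0 | d0 rt0 s1].
(* With [n] generalized again, unification reads [f] and [G] off the goal. *)
- move: n; refine (telescope_sum_div (C_neq0 _ d0) _ _).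
  + by rewrite /= oppr0 !add0r w2 w1 w0; ring.
  + move=> k.
    have -> : - k.+1%:Z = - k%:Z - 1 by rewrite (intS k); ring.
    set m := - k%:Z.
    have -> : m - 1 - 1 = m - 2 by ring.
    have -> : m - 1 - 2 = m - 3 by ring.
    have -> : m - 1 - 3 = m - 4 by ring.
    (* This expresses everything in the three consecutive terms at [m - 2], [m - 3], [m - 4], so
       that [ring] can compare coefficients. *)
    have -> : W (m - 1) = r%:C * W (m - 2) + s%:C * W (m - 3) + t%:C * W (m - 4).
      by rewrite rec; congr (_ * W _ + _ * W _ + _ * W _); ring.
    ring.
- split.
  + move: n; refine (telescope_sum_div (C_neq0 _ d0) _ _).
    * by rewrite /= mulr0 oppr0 !add0r h1 h0 w2; ring.
    (* With [m = - (2 * k)], eliminating [W (m + 1)] and then [W m] leaves only the terms at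
       [m - 1], [m - 2], [m - 3]. *)
    * by move=> k; rewrite oddS odd'S evenS rec1 (rec (- (2 * k%:Z))); ring.
  + move: n; refine (telescope_sum_div (C_neq0 _ d0) _ _).
    * by rewrite /= mulr0 oppr0 !add0r h1 h0 w2; ring.
    * by move=> k; rewrite oddS odd'S evenS rec1 (rec (- (2 * k%:Z))); ring.
(* Instead of cancelling in (b), the reduced numerators are telescoped afresh with [d = s - 1],
   after substituting [r = - t]. *)
- have s10 : (s - 1)%:C != 0 :> R[i] by rewrite C_neq0 // subr_eq0.
  have rE : r = - t by apply/eqP; rewrite -addr_eq0 rt0.
  subst r; split.
  + move: n; refine (telescope_sum_div s10 _ _).
    * by rewrite /= mulr0 oppr0 !add0r h0 w2; ring.
    * by move=> k; rewrite odd'S evenS (rec (- (2 * k%:Z))); ring.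
  + rewrite mul1r [RHS]mulrC.
    move: n; refine (telescope_sum_div s10 _ _).
    * by rewrite /= mulr0 oppr0 !add0r h1 h0; ring.
    (* One use of the recurrence suffices: its term [- t * W (- (2 * k))] cancels the one already in
       [G k]. *)
    * by move=> k; rewrite oddS evenS rec1; ring.
Qed.
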